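(* Let $\mathcal{F}:\mathcal{H}_2\to\mathbb{R}$ be any function on the Siegel upper half-space $\mathcal{H}_2$ which is invariant under the action of $\mathrm{Sp}(4,\mathbb{Z})$ and which is $C^1$ in open neighborhoods of the points $$\mathbf{B}_1=\begin{pmatrix} \frac{i}{\sqrt{2}}-\frac{1}{2} & \frac{1}{2} \\ \frac{1}{2} & \frac{i}{\sqrt{2}}-\frac{1}{2}\end{pmatrix},\qquad \mathbf{B}_2=\frac{i}{\sqrt{3}}\begin{pmatrix} 2 & 1 \\ 1 & 2\end{pmatrix},\qquad \mathbf{B}_3=\begin{pmatrix} \epsilon_5 & \frac{\epsilon_5}{1+\epsilon_5} \\ \frac{\epsilon_5}{1+\epsilon_5} & 1-\epsilon_5^4\end{pmatrix},$$ where $\epsilon_5=e^{2\pi i/5}$; these are the matrices of $b$-periods (in suitable canonical bases of cycles) of the curves with large automorphism groups $y^2=x(x^4-1)$, $y^2=x^6-1$ and $y^2=x^5-1$ respectively. Then the gradient of $\mathcal{F}$ vanishes at the points $\mathbf{B}_1$, $\mathbf{B}_2$ and $\mathbf{B}_3$.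
   Context: $\mathcal{H}_2$ denotes the space of complex symmetric $2\times 2$ matrices $\mathbf{B}$ with positive definite imaginary part. A matrix $T=\begin{pmatrix}A&B'\\C&D\end{pmatrix}\in\mathrm{Sp}(4,\mathbb{Z})$ (with $2\times2$ blocks) acts on $\mathcal{H}_2$ by $\mathbf{B}\mapsto (A\mathbf{B}+B')(C\mathbf{B}+D)^{-1}$; invariance means $\mathcal{F}(T\cdot\mathbf{B})=\mathcal{F}(\mathbf{B})$ for all $T$ and $\mathbf{B}$. The gradient is taken with respect to the real coordinates given by the real and imaginary parts of the three independent entries $\mathbf{B}_{11},\mathbf{B}_{12},\mathbf{B}_{22}$. *)

(* Defs.v *)
From HB Require Import structures.
From mathcomp Require Import all_boot all_order all_algebra.
From mathcomp Require Import all_classical all_reals all_analysis.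
From mathcomp Require Import complex.
Set Implicit Arguments. Unset Strict Implicit. Unset Printing Implicit Defensive.
Import Order.TTheory GRing.Theory Num.Theory.
Import numFieldNormedType.Exports.
Local Open Scope ring_scope.
Local Open Scope classical_set_scope.

Section Siegel.
Variable R : realType.
Local Notation C := (R[i]).

Definition Im_mx (Z : 'M[C]_2) : 'M[R]_2 := map_mx (@complex.Im R) Z.

Definition posdef (Y : 'M[R]_2) : Prop :=
  forall v : 'rV[R]_2, v != 0 -> 0 < (v *m Y *m v^T) 0 0.

Definition H2 : set 'M[C]_2 := [set Z | Z^T = Z /\ posdef (Im_mx Z)].

Definition Jmx : 'M[int]_(2 + 2) := block_mx 0 1%:M (- 1%:M) 0.

Definition Sp4Z : set 'M[int]_(2 + 2) := [set T | T^T *m Jmx *m T = Jmx].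

Definition intmx (M : 'M[int]_2) : 'M[C]_2 := map_mx (fun z : int => z%:~R) M.

Definition sp_act (T : 'M[int]_(2 + 2)) (Z : 'M[C]_2) : 'M[C]_2 :=
  (intmx (ulsubmx T) *m Z + intmx (ursubmx T))
    *m invmx (intmx (dlsubmx T) *m Z + intmx (drsubmx T)).

Definition coords (x : 'rV[R]_6) : 'M[C]_2 :=
  \matrix_(i < 2, j < 2)
    (if (i == 0) && (j == 0) then (x 0 0 +i* x 0 1)%C
     else if (i == 1) && (j == 1) then (x 0 4 +i* x 0 5)%C
     else (x 0 2 +i* x 0 3)%C).

Definition evec (k : 'I_6) : 'rV[R]_6 := delta_mx 0 k.

Definition C1_near (F : 'M[C]_2 -> R) (B : 'M[C]_2) : Prop :=
  exists U : set 'rV[R]_6,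
    [/\ open U, U `<=` coords @^-1` H2,
        (exists2 p, U p & coords p = B) ,
        (forall k q, U q -> derivable (F \o coords) q (evec k)) &
        (forall k q, U q ->
           {for q, continuous (fun y => 'D_(evec k) (F \o coords) y)})].

Definition grad_vanishes (F : 'M[C]_2 -> R) (B : 'M[C]_2) : Prop :=
  forall p, coords p = B -> forall k, 'D_(evec k) (F \o coords) p = 0.

Definition sqrtR (x : R) : C := (Num.sqrt x)%:C%C.

Definition B1 : 'M[C]_2 :=
  \matrix_(i < 2, j < 2)
    (if i == j then 'i%C / sqrtR 2 - 2^-1 else 2^-1).

Definition B2 : 'M[C]_2 :=
  ('i%C / sqrtR 3) *: \matrix_(i < 2, j < 2) (if i == j then 2 else 1).

Definition eps5 : C := (cos (2 * pi / 5) +i* sin (2 * pi / 5))%C.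

Definition B3 : 'M[C]_2 :=
  \matrix_(i < 2, j < 2)
    (if (i == 0) && (j == 0) then eps5
     else if (i == 1) && (j == 1) then 1 - eps5 ^+ 4
     else eps5 / (1 + eps5)).

End Siegel.

(* Main.v *)
(* Each of the three points B is fixed by some T = (A, B'; C, D) of Sp(4, Z).
   With W = C B + D, the action satisfies
     T.Z = B + W^-T (Z - B) (C Z + D)^-1,
   so its differential at B is H |-> W^-T H W^-1 on complex symmetric matrices,
   and the differential of F at B is invariant under it. When W has eigenvalues
   l, m with l^2, l m, m^2 all different from 1, this map has no eigenvalue 1,
   so an invariant real-linear functional must be zero. *)
Require Import Defs.
From HB Require Import structures.
From mathcomp Require Import all_boot all_order all_algebra.
From mathcomp Require Import all_classical all_reals all_analysis.
From mathcomp Require Import complex.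
From mathcomp Require Import ring lra.
Import Order.TTheory GRing.Theory Num.Theory.
Import numFieldNormedType.Exports.
Local Open Scope ring_scope.
Local Open Scope classical_set_scope.

(** * Continuous partial derivatives imply differentiability *)

(** One-variable mean value theorem for [u x = f (a + x *: e)], whose derivative is the directional
    derivative of [f]. Only derivability along [e] is assumed, and [c] may have either sign, since
    the coordinates of an increment do. *)
Lemma MVT_along {R : realType} {V : normedModType R} (f : V -> R) (a e : V)
    (c : R) :
  (forall x, `|x| <= `|c| -> derivable f (a + x *: e) e) ->
  exists2 x, `|x| <= `|c| &
    f (a + c *: e) - f a = c * 'D_e f (a + x *: e).
Proof.
move=> fd; pose u (x : R) : R := f (a + x *: e).
have ud (x : R) : `|x| <= `|c| -> is_derive x 1 u ('D_e f (a + x *: e)).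
  move=> /fd fdx.
  have E : (fun h => h^-1 *: ((u \o shift x) (h *: 1) - u x)) =
           (fun h => h^-1 *: ((f \o shift (a + x *: e)) (h *: e) - f (a + x *: e))).
    apply/funext => h /=; rewrite /u; congr (_ *: (f _ - _)).
    by rewrite [h *: 1]mulr1 scalerDl addrCA.
  by split; [rewrite /derivable E|rewrite /derive E].
have uc (l r : R) : (forall x, x \in `[l, r]%R -> `|x| <= `|c|) ->
    {within `[l, r], continuous u}.
  move=> lr; by apply: derivable_within_continuous => x /lr /ud [].
have [c0|c0] := leP 0 c.
  have Hc x : x \in `[0, c]%R -> `|x| <= `|c|.
    by rewrite in_itv /= => /andP[x0 xc]; rewrite !ger0_norm.
  have [||x xI] := @MVT_segment R u (fun x => 'D_e f (a + x *: e)) 0 c c0.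
  - by move=> x xI; apply/ud/Hc/(subset_itv_oo_cc xI).
  - exact: uc.
  rewrite /u scale0r addr0 subr0 mulrC => E.
  by exists x; [exact: Hc|].
have Hc x : x \in `[c, 0]%R -> `|x| <= `|c|.
  by rewrite in_itv /= => /andP[x0 xc]; rewrite !ler0_norm ?lerN2// ltW.
have [||x xI] := @MVT_segment R u (fun x => 'D_e f (a + x *: e)) c 0 (ltW c0).
- by move=> x xI; apply/ud/Hc/(subset_itv_oo_cc xI).
- exact: uc.
rewrite /u scale0r addr0 sub0r mulrN mulrC => E.
by exists x; [exact: Hc|rewrite -opprB E opprK].
Qed.

(** The bound is the expansion of [f] at [p] with a little-o remainder, and uniqueness of the
    differential identifies [df] with ['d f p]. *)
Lemma differentiable_eps {K : numFieldType} {V W : normedModType K} (f : V -> W)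
    (p : V) (df : {linear V -> W}) :
  continuous df ->
  (forall e, 0 < e -> \forall h \near (0 : V),
     `|f (p + h) - f p - df h| <= e * `|h|) ->
  differentiable f p.
Proof.
move=> dfc fdf; have E : f \o shift p = cst (f p) + df +o_ 0 id.
  apply/eqaddoP => e e0; apply: filterS (fdf e e0) => h /=.
  by rewrite opprD addrA [p + h]addrC.
by apply/diff_locallyP; rewrite (diff_unique _ E).
Qed.

Section C1Differentiable.
Context {R : realType} {n : nat}.
Implicit Types (f : 'rV[R]_n -> R) (p h : 'rV[R]_n).

Let dot (c h : 'rV[R]_n) : R := \sum_k h 0 k * c 0 k.

Let dot_is_linear c : linear (dot c).
Proof.
move=> a u v; rewrite /dot scaler_sumr -big_split; apply: eq_bigr => k _ /=.
by rewrite !mxE mulrDl -mulrA.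
Qed.

HB.instance Definition _ c :=
  GRing.isLinear.Build R 'rV[R]_n R _ (dot c) (dot_is_linear c).

Let dot_continuous c : continuous (dot c).
Proof.
rewrite /dot; apply: continuous_big => [|k _ x]; first exact: add_continuous.
apply: (@continuousM R _ (fun h : 'rV[R]_n => h 0 k) (fun=> c 0 k)).
  exact: coord_continuous.
exact: cst_continuous.
Qed.

(** The points [p + trunc j h] are the vertices of an axis-parallel path from [p] to [p + h]. *)
Let trunc j h : 'rV[R]_n := \row_k (if (k < j)%N then h 0 k else 0).

Let truncS h (j : 'I_n) : trunc j.+1 h = trunc j h + h 0 j *: delta_mx 0 j.
Proof.
apply/rowP => k; rewrite !mxE eqxx ltnS leq_eqVlt -val_eqE /=.
case: (ltngtP k j) => //= [_|_|kj]; rewrite ?mulr0 ?addr0// mulr1 add0r.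
by congr (h 0 _); exact: val_inj.
Qed.

Let norm_step h (j : 'I_n) x : `|x| <= `|h 0 j| ->
  `|trunc j h + x *: delta_mx 0 j| <= `|h|.
Proof.
move=> xh; have hk k : `|h 0 k| <= `|h|.
  by rewrite [leRHS]/Num.Def.normr/= mx_normrE; exact: (le_bigmax _ _ (0, k)).
rewrite [leLHS]/Num.Def.normr/= mx_normrE; apply: bigmax_le => //= -[i k] _ /=.
rewrite !mxE (ord1 i) eqxx -val_eqE /=.
case: (ltngtP k j) => //= [_|_|_]; rewrite ?mulr0 ?addr0 ?normr0// mulr1 add0r.
exact: le_trans xh (hk _).
Qed.

(** The increment of [f] telescopes along the path of truncations. The mean value theorem turns each
    edge into a partial derivative at a nearby point, which continuity compares with the one at
    [p]. *)
Lemma C1_differentiable f p :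
  (forall k, \forall q \near p, derivable f q (delta_mx 0 k)) ->
  (forall k, {for p, continuous (fun q => 'D_(delta_mx 0 k) f q)}) ->
  differentiable f p.
Proof.
move=> fd fc; pose c := \row_k 'D_(delta_mx 0 k) f p.
apply: (@differentiable_eps _ _ _ f p (dot c)) => [|e e_gt0].
  exact: dot_continuous.
(* Each of the [n] edges may contribute an error [e' * |h|]. Dividing by [n + 1] keeps the total
   below [e * |h|] and also covers [n = 0]. *)
have n0 : 0 < n.+1%:R :> R by [].
pose e' := e / n.+1%:R.
have e'0 : 0 < e' by rewrite divr_gt0.
have : \forall q \near p, forall k, derivable f q (delta_mx 0 k) /\
    `|'D_(delta_mx 0 k) f q - 'D_(delta_mx 0 k) f p| <= e'.
  apply: (@filter_forall _ _ (fun k q => derivable f q (delta_mx 0 k) /\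
    `|'D_(delta_mx 0 k) f q - 'D_(delta_mx 0 k) f p| <= e') (nbhs p)) => k.
  have := fc k; move=> /cvgrPdist_le /(_ _ e'0) H.
  near=> q; split; first by near: q; exact: fd.
  by rewrite distrC; near: q.
move=> /nbhs_ballP[d /= d0 dP].
near=> h.
have hd : `|h| < d by near: h; exact: (@nbhs0_lt R 'rV[R]_n d d0).
have -> : f (p + h) - f p - dot c h =
    \sum_(j < n) (f (p + trunc j.+1 h) - f (p + trunc j h) - h 0 j * c 0 j).
  rewrite sumrB.
  rewrite -(big_mkord xpredT (fun j => f (p + trunc j.+1 h) - f (p + trunc j h))).
  rewrite telescope_sumr//.
  have -> : trunc n h = h by apply/rowP => k; rewrite mxE ltn_ord.
  have -> : trunc 0 h = 0 by apply/rowP => k; rewrite !mxE.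
  by rewrite addr0.
have step (j : 'I_n) : `|f (p + trunc j.+1 h) - f (p + trunc j h) - h 0 j * c 0 j|
    <= e' * `|h|.
  (* every point of the axis-parallel path from p to p + h is within |h| of p *)
  have Pd x : `|x| <= `|h 0 j| ->
      ball p d (p + trunc j h + x *: delta_mx 0 j).
    move=> /norm_step xh; rewrite -ball_normE /= -addrA opprD addNKr normrN.
    exact: le_lt_trans xh hd.
  have [x xh E] := @MVT_along R 'rV[R]_n f (p + trunc j h) (delta_mx 0 j) (h 0 j)
    (fun x xh => (dP _ (Pd x xh) j).1).
  rewrite truncS addrA E /c mxE -mulrBr normrM mulrC ler_pM//.
    exact: (dP _ (Pd x xh) j).2.
  by rewrite [leRHS]/Num.Def.normr/= mx_normrE; exact: (le_bigmax _ _ (0, j)).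
apply: (le_trans (ler_norm_sum _ _ _)).
apply: (le_trans (ler_sum _ (fun j _ => step j))).
rewrite sumr_const card_ord /= -[leLHS]mulr_natl /e' !mulrA ler_wpM2r//.
by rewrite ler_pdivrMr// mulrC ler_wpM2l ?ler_nat// ltW.
Unshelve. all: by end_near. Qed.
End C1Differentiable.

(** * The symplectic action near a fixed point *)

Section Symplectic.
Context {R : realType}.
Local Notation C := R[i].
Implicit Types (T : 'M[int]_(2 + 2)) (Z B : 'M[C]_2).

Definition sp_num T Z := intmx R (ulsubmx T) *m Z + intmx R (ursubmx T).
Definition sp_den T Z := intmx R (dlsubmx T) *m Z + intmx R (drsubmx T).

(** The four blocks of T^T J T = J, solved for the products that [Sp4Z_den_num] rewrites. *)
Lemma Sp4Z_blocks T (a := ulsubmx T) (b := ursubmx T) (c := dlsubmx T)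
    (d := drsubmx T) : Sp4Z T ->
  [/\ c^T *m a = a^T *m c, c^T *m b = a^T *m d - 1%:M,
      d^T *m a = b^T *m c + 1%:M & d^T *m b = b^T *m d].
Proof.
rewrite /Sp4Z /= -{1 2}[T]submxK -/a -/b -/c -/d /Jmx.
rewrite tr_block_mx !mulmx_block.
rewrite !(mulmx0, mul0mx, mulmx1, mulmxN, mulNmx, add0r, addr0).
case/eq_block_mx; rewrite ![- _ + _]addrC => ac ad da bd; split.
- by apply/esym/subr0_eq.
- by rewrite -ad opprB addrC subrK.
- by rewrite -[1%:M]opprK -da opprB addrC subrK.
- by apply/esym/subr0_eq.
Qed.

(* Evaluate T^T J T = J on the 4x2 matrices (B; 1) and (Z; 1). *)
Lemma Sp4Z_den_num T Z B : Sp4Z T -> B^T = B ->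
  (sp_den T B)^T *m sp_num T Z - (sp_num T B)^T *m sp_den T Z = Z - B.
Proof.
move=> /Sp4Z_blocks; rewrite /sp_den /sp_num.
move: (ulsubmx T) (ursubmx T) (dlsubmx T) (drsubmx T) => a b c d E sB.
have intmxM (M N : 'M[int]_2) : intmx R (M^T *m N) = (intmx R M)^T *m intmx R N.
  by rewrite /intmx map_mxM map_trmx.
have intmxD (M N : 'M[int]_2) : intmx R (M + N) = intmx R M + intmx R N.
  exact: map_mxD.
have intmxB (M N : 'M[int]_2) : intmx R (M - N) = intmx R M - intmx R N.
  exact: map_mxB.
have intmx1 : intmx R 1%:M = 1%:M by exact: map_mx1.
case: E => /(congr1 (intmx R)) + /(congr1 (intmx R)) + /(congr1 (intmx R)) +
  /(congr1 (intmx R)).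
rewrite !(intmxB, intmxD, intmxM) intmx1 => ac ad da bd.
rewrite ![(_ + _)^T]raddfD /= !trmx_mul sB.
rewrite !mulmxDl !mulmxDr -!mulmxA bd ad.
rewrite ![_^T *m (_ *m Z)]mulmxA da ac mulmxDl mulmxBr mul1mx mulmx1.
by apply/matrixP => i j; rewrite !mxE; ring.
Qed.

(** For B = Z the identity [Sp4Z_den_num] says that den^T num is symmetric; multiplying by den^-T on
    the left and den^-1 on the right gives the claim. *)
Lemma sp_act_sym T Z : Sp4Z T -> Z^T = Z -> sp_den T Z \in unitmx ->
  (sp_act T Z)^T = sp_act T Z.
Proof.
move=> spT sZ uZ; have := Sp4Z_den_num T Z Z spT sZ; rewrite subrr.
move=> /subr0_eq E; rewrite -[sp_act T Z]/(sp_num T Z *m invmx (sp_den T Z)).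
have uZ' : (sp_den T Z)^T \in unitmx by rewrite unitmx_tr.
apply: (can_inj (mulKmx uZ')).
rewrite -trmx_mul -mulmxA mulVmx// mulmx1 mulmxA E -mulmxA mulmxV//.
by rewrite mulmx1.
Qed.

(** With num B = B W, the identity [Sp4Z_den_num] reads W^T (num Z - B den Z) = Z - B. The formula
    is exact, so the differential of the action at B will need only the continuity of den and of
    inversion. *)
Lemma sp_act_sub_fixed T Z B : Sp4Z T -> B^T = B ->
  sp_num T B = B *m sp_den T B ->
  sp_den T B \in unitmx -> sp_den T Z \in unitmx ->
  sp_act T Z = B + (invmx (sp_den T B))^T *m (Z - B) *m invmx (sp_den T Z).
Proof.
move=> spT sB fixB uB uZ.
have := Sp4Z_den_num T Z B spT sB; rewrite fixB trmx_mul sB => <-.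
have uB' : (sp_den T B)^T \in unitmx by rewrite unitmx_tr.
rewrite trmx_inv mulmxBr mulmxBl !mulmxA mulVmx// !mul1mx mulmxK//.
by rewrite addrC subrK.
Qed.

End Symplectic.

(** * Entrywise limits of matrices and limits in the complex numbers *)

Section MatrixConvergence.
Context {K : numFieldType} {T : Type} {F : set_system T} {FF : Filter F}.

Lemma cvg_det {n} (M : T -> 'M[K]_n) (A : 'M[K]_n) :
  (forall i j, M x i j @[x --> F] --> A i j) ->
  \det (M x) @[x --> F] --> \det A.
Proof.
move=> MA; rewrite /determinant.
apply: cvg_big => [|s _]; first exact: add_continuous.
apply: cvgMl_tmp; apply: cvg_big => [|i _]; last exact: MA.
exact: mul_continuous.
Qed.

Lemma cvg_mulmx {m n p} (M : T -> 'M[K]_(m, n)) (N : T -> 'M[K]_(n, p))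
    (A : 'M[K]_(m, n)) (B : 'M[K]_(n, p)) :
  (forall i j, M x i j @[x --> F] --> A i j) ->
  (forall i j, N x i j @[x --> F] --> B i j) ->
  forall i j, (M x *m N x) i j @[x --> F] --> (A *m B) i j.
Proof.
move=> MA NB i j; rewrite mxE; under eq_cvg do rewrite mxE.
apply: cvg_big => [|k _]; first exact: add_continuous.
by apply: cvgM; [exact: MA|exact: NB].
Qed.

Lemma near_unitmx {n} (M : T -> 'M[K]_n) (A : 'M[K]_n) : A \in unitmx ->
  (forall i j, M x i j @[x --> F] --> A i j) ->
  \forall x \near F, M x \in unitmx.
Proof.
rewrite unitmxE unitfE => dA MA.
apply: (filterS _ (cvgr_neq0 _ (cvg_det M A MA) dA)) => x /=.
by rewrite unitmxE unitfE.
Qed.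

Lemma cvg_invmx {n} (M : T -> 'M[K]_n) (A : 'M[K]_n) : A \in unitmx ->
  (forall i j, M x i j @[x --> F] --> A i j) ->
  forall i j, invmx (M x) i j @[x --> F] --> invmx A i j.
Proof.
move=> uA MA i j; rewrite /invmx uA !mxE.
have : ((\det (M x))^-1 * cofactor (M x) j i @[x --> F] -->
  (\det A)^-1 * cofactor A j i).
  apply: cvgM.
    by apply: cvgV; [rewrite -unitfE -unitmxE|exact: cvg_det].
  apply: cvgMl_tmp; apply: cvg_det => k l; rewrite !mxE.
  by under eq_cvg do rewrite !mxE; exact: MA.
apply: cvg_trans; apply: near_eq_cvg.
by apply: filterS (near_unitmx M A uA MA) => x ux; rewrite ux !mxE.
Qed.

End MatrixConvergence.

Section ComplexConvergence.
Context {R : realType} {T : Type} {F : set_system T} {FF : Filter F}.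

Lemma cvg_real_complex (f : T -> R) (l : R) : f x @[x --> F] --> l ->
  ((f x)%:C%C : (R[i] : numFieldType)) @[x --> F] -->
  (l%:C%C : (R[i] : numFieldType)).
Proof.
move=> /cvgrPdist_lt fl; apply/cvgrPdist_lt => -[e e'].
(* A positive element of [R[i]] has zero imaginary part, so the tolerance is real. *)
rewrite ltcE /= => /andP[/eqP -> e0].
apply: filterS (fl e e0) => x.
by rewrite -rmorphB /= normc_def /= expr0n /= addr0 sqrtr_sqr ltcR.
Qed.

Lemma cvg_Re (f : T -> (R[i] : numFieldType)) (l : (R[i] : numFieldType)) :
  f x @[x --> F] --> l -> complex.Re (f x) @[x --> F] --> complex.Re l.
Proof.
move=> /cvgrPdist_lt fl; apply/cvgrPdist_lt => e e0.
have e0' : 0 < e%:C%C :> R[i] by rewrite ltcR.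
apply: filterS (fl _ e0') => x; rewrite -ltcR; apply: le_lt_trans.
have -> : complex.Re l - complex.Re (f x) = complex.Re (l - f x).
  by case: (l) (f x) => a b [c d].
exact: normc_ge_Re.
Qed.

Lemma cvg_Im (f : T -> (R[i] : numFieldType)) (l : (R[i] : numFieldType)) :
  f x @[x --> F] --> l -> complex.Im (f x) @[x --> F] --> complex.Im l.
Proof.
move=> fl; have ImE (z : R[i]) : complex.Im z = complex.Re (z * - 'i%C).
  by rewrite mulrN raddfN /= ReiNIm opprK.
rewrite ImE; under eq_cvg do rewrite ImE.
by apply: cvg_Re; apply: cvgMr_tmp.
Qed.

End ComplexConvergence.

(** * Calculus of 2 x 2 matrices *)

Lemma ord2P (i : 'I_2) : i = 0 \/ i = 1.
Proof. by case: i => -[|[|//]] ?; [left|right]; exact: val_inj. Qed.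

Lemma sum2 (V : nmodType) (G : 'I_2 -> V) : \sum_i G i = G 0 + G 1.
Proof. by rewrite big_ord_recl big_ord1; congr (_ + G _); exact: val_inj. Qed.

Lemma det_mx22 {S : comPzRingType} (M : 'M[S]_2) :
  \det M = M 0 0 * M 1 1 - M 0 1 * M 1 0.
Proof.
rewrite (expand_det_row _ 0) sum2 /cofactor !det_mx11 !mxE /=.
rewrite expr0 expr1 mul1r mulN1r mulrN.
by congr (_ * M _ _ - _ * M _ _); exact: val_inj.
Qed.

Lemma tr_mx22 {S : pzRingType} (M : 'M[S]_2) : \tr M = M 0 0 + M 1 1.
Proof. by rewrite /mxtrace sum2. Qed.

Section TwoByTwo.

Definition mx2 {S : Type} (a b c d : S) : 'M[S]_2 :=
  \matrix_(i, j) (if i == 0 then if j == 0 then a else b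
                  else if j == 0 then c else d).

Context {S : pzRingType}.
Implicit Types a b c d : S.

Lemma mx2P (M N : 'M[S]_2) : M 0 0 = N 0 0 -> M 0 1 = N 0 1 ->
  M 1 0 = N 1 0 -> M 1 1 = N 1 1 -> M = N.
Proof.
move=> h00 h01 h10 h11; apply/matrixP => i j.
by have [->|->] := ord2P i; have [->|->] := ord2P j.
Qed.

Lemma mx2M a b c d a' b' c' d' : mx2 a b c d *m mx2 a' b' c' d' =
  mx2 (a * a' + b * c') (a * b' + b * d') (c * a' + d * c') (c * b' + d * d').
Proof. by apply: mx2P; rewrite !mxE sum2 !mxE. Qed.

Lemma mx2D a b c d a' b' c' d' :
  mx2 a b c d + mx2 a' b' c' d' = mx2 (a + a') (b + b') (c + c') (d + d').
Proof. by apply: mx2P; rewrite !mxE. Qed.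

Lemma map_mx2 {S' : Type} (f : S -> S') a b c d :
  map_mx f (mx2 a b c d) = mx2 (f a) (f b) (f c) (f d).
Proof.
apply/matrixP => i j; rewrite !mxE.
by have [->|->] := ord2P i; have [->|->] := ord2P j.
Qed.

End TwoByTwo.

(** * Functionals invariant under the symmetric square of a 2 x 2 matrix *)

Section SymmetricSquare.
Context {R : realType}.
Local Notation C := R[i].

Lemma Re_mul_eq0 (a : C) : (forall z, complex.Re (a * z) = 0) -> a = 0.
Proof.
move=> h; have := h 1; have := h 'i%C; rewrite mulr1 ReiNIm.
by case: a {h} => x y /= /eqP; rewrite oppr_eq0 => /eqP -> ->.
Qed.

Definition sym_form (a b c : C) (K : 'M[C]_2) : C :=
  a * K 0 0 + b * K 0 1 + c * K 1 1.

(* Every real-linear functional on symmetric matrices has the form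
   [Re \o sym_form a b c]. If [W] has eigenvalues l and m then K |-> W^T K W has
   eigenvalues l^2, l m, m^2 on symmetric matrices, and
   (1 - l^2) (1 - l m) (1 - m^2) = (1 - det W) ((1 + det W)^2 - (tr W)^2).
   The solutions below are the adjugate of the 3x3 system. *)
Lemma sym_form_eq0 (W : 'M[C]_2) (a b c : C) :
  \det W != 1 -> (1 + \det W) ^+ 2 != \tr W ^+ 2 ->
  (forall x y z, complex.Re (sym_form a b c (W^T *m mx2 x y y z *m W)) =
                 complex.Re (sym_form a b c (mx2 x y y z))) ->
  [/\ a = 0, b = 0 & c = 0].
Proof.
move=> d1 d2; set m := W 0 0; set n := W 0 1; set p := W 1 0; set q := W 1 1.
have detW := det_mx22 W; have trW := tr_mx22 W.
rewrite -/m -/n -/p -/q in detW trW.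
(* The coefficients of x, y and z in the difference of the two forms in the hypothesis. As x, y, z
   are arbitrary complex numbers, all three vanish. *)
pose r1 := (m ^+ 2 - 1) * a + m * n * b + n ^+ 2 * c.
pose r2 := 2 * m * p * a + (m * q + n * p - 1) * b + 2 * n * q * c.
pose r3 := p ^+ 2 * a + p * q * b + (q ^+ 2 - 1) * c.
move=> h.
have E x y z : complex.Re (r1 * x + r2 * y + r3 * z) = 0.
  have := h x y z; move/eqP; rewrite -subr_eq0 -raddfB /= => /eqP.
  move=> <-; congr complex.Re; rewrite /sym_form !mxE !sum2 !mxE !sum2 !mxE /=.
  by rewrite -/m -/n -/p -/q /r1 /r2 /r3; ring.
have r10 : r1 = 0.
  by apply: Re_mul_eq0 => z; rewrite -(E z 0 0) !mulr0 !addr0.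
have r20 : r2 = 0.
  by apply: Re_mul_eq0 => z; rewrite -(E 0 z 0) !mulr0 !addr0 add0r.
have r30 : r3 = 0.
  by apply: Re_mul_eq0 => z; rewrite -(E 0 0 z) !mulr0 !add0r.
(* The determinant of the linear system r1 = r2 = r3 = 0 in a, b, c, namely (l^2 - 1) (l m - 1) (m^2
   - 1); this accounts for the sign. *)
pose D := - ((1 - \det W) * ((1 + \det W) ^+ 2 - \tr W ^+ 2)).
have D0 : D != 0.
  by rewrite oppr_eq0 mulf_neq0// subr_eq0// eq_sym.
have sol x (c1 c2 c3 : C) : D * x = c1 * r1 + c2 * r2 + c3 * r3 -> x = 0.
  rewrite r10 r20 r30 !mulr0 !addr0 => /eqP.
  by rewrite mulf_eq0 (negbTE D0) => /eqP.
split.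
- apply: (sol _ ((m * q + n * p - 1) * (q ^+ 2 - 1) - 2 * n * q * (p * q))
    (n ^+ 2 * (p * q) - m * n * (q ^+ 2 - 1))
    (m * n * (2 * n * q) - n ^+ 2 * (m * q + n * p - 1))).
  by rewrite /D /r1 /r2 /r3 detW trW; ring.
- apply: (sol _ (2 * n * q * p ^+ 2 - 2 * m * p * (q ^+ 2 - 1))
    ((m ^+ 2 - 1) * (q ^+ 2 - 1) - n ^+ 2 * p ^+ 2)
    (n ^+ 2 * (2 * m * p) - (m ^+ 2 - 1) * (2 * n * q))).
  by rewrite /D /r1 /r2 /r3 detW trW; ring.
- apply: (sol _ (2 * m * p * (p * q) - (m * q + n * p - 1) * p ^+ 2)
    (m * n * p ^+ 2 - (m ^+ 2 - 1) * (p * q))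
    ((m ^+ 2 - 1) * (m * q + n * p - 1) - m * n * (2 * m * p))).
  by rewrite /D /r1 /r2 /r3 detW trW; ring.
Qed.

End SymmetricSquare.

(** * Real coordinates on complex symmetric matrices *)

Section Coordinates.
Context {R : realType}.
Local Notation C := R[i].

Definition real_coords (Z : 'M[C]_2) : 'rV[R]_6 :=
  \row_k nth 0 [:: complex.Re (Z 0 0); complex.Im (Z 0 0);
    complex.Re (Z 0 1); complex.Im (Z 0 1);
    complex.Re (Z 1 1); complex.Im (Z 1 1)] k.

Lemma coordsK : cancel (@coords R) real_coords.
Proof.
move=> x; apply/rowP => -[[|[|[|[|[|[|//]]]]]] k]; rewrite !mxE /=;
  by congr (x 0 _); exact: val_inj.
Qed.

Lemma coords_sym (x : 'rV[R]_6) : (coords x)^T = coords x.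
Proof.
apply/matrixP => i j; rewrite !mxE.
by have [->|->] := ord2P i; have [->|->] := ord2P j.
Qed.

Lemma real_coordsK (Z : 'M[C]_2) : Z^T = Z -> coords (real_coords Z) = Z.
Proof.
move=> sZ; have Z10 : Z 1 0 = Z 0 1 by rewrite -[in LHS]sZ mxE.
apply/matrixP => i j; rewrite !mxE /=.
by have [->|->] := ord2P i; have [->|->] := ord2P j; rewrite /= ?Z10;
  case: (Z _ _).
Qed.

Lemma coords_line (p v : 'rV[R]_6) (t : R) :
  coords (p + t *: v) = coords p + t%:C%C *: coords v.
Proof.
apply/matrixP => i j; rewrite !mxE.
by case: ifP => _; [|case: ifP => _];
  apply/eqP; rewrite eq_complex /= !(mxE, mul0r) subr0 addr0 !eqxx.
Qed.

Lemma real_coords_line (B Y : 'M[C]_2) (t : R) :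
  real_coords (B + t%:C%C *: Y) = real_coords B + t *: real_coords Y.
Proof.
have ReE (a b : C) : complex.Re (a + t%:C%C * b) = complex.Re a + t * complex.Re b.
  by case: a b => ? ? [? ?]; rewrite /= mul0r subr0.
have ImE (a b : C) : complex.Im (a + t%:C%C * b) = complex.Im a + t * complex.Im b.
  by case: a b => ? ? [? ?]; rewrite /= mul0r addr0.
by apply/rowP => -[[|[|[|[|[|[|//]]]]]] k]; rewrite !mxE /= ?ReE ?ImE.
Qed.

End Coordinates.

(** * Derivatives along curves of the form p + t g(t) *)

Section DeriveAlongCurve.
Context {R : realType}.

(** The difference quotient at 0 is exactly [g h], so the convergence of [g] suffices and [g] need
    not be derivable. *)
Lemma is_derive_addM (a l : R) (g : R -> R) : g t @[t --> 0] --> l ->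
  is_derive (0 : R) (1 : R) (fun t => a + t * g t) l.
Proof.
move=> gl; have H : h^-1 *: (((fun t => a + t * g t) \o shift 0) (h *: 1) -
    (a + 0 * g 0)) @[h --> 0^'] --> l.
  have : g t @[t --> 0^'] --> l.
    by apply: cvg_trans gl; exact: cvg_app (@nbhs_dnbhs _ _).
  apply: cvg_trans; apply: near_eq_cvg; near=> h.
  have h0 : h != 0 by near: h; exact: nbhs_dnbhs_neq.
  rewrite /= addr0 mul0r addr0 [a + _]addrC addrK [h *: 1]mulr1.
  by rewrite [RHS]mulrA mulVf// mul1r.
split; first by apply/cvg_ex; exists l.
exact/cvg_lim.
Unshelve. all: by end_near. Qed.

(** Chain rule: the curve has velocity [w] at 0, computed entry by entry with [is_derive_addM]. *)
Lemma derive_along_curve {n} (f : 'rV[R]_n -> R) (p w : 'rV[R]_n)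
    (g : R -> 'rV[R]_n) : differentiable f p ->
  (forall k, g t 0 k @[t --> 0] --> w 0 k) ->
  'D_(1 : R) (fun t : R => f (p + t *: g t)) 0 = 'd f p w.
Proof.
move=> df gw; pose c (t : R) := p + t *: g t.
have c0 : c 0 = p by rewrite /c scale0r addr0.
have cE i j : (fun t : R => c t i j) = (fun t => p i j + t * g t i j).
  by apply/funext => t; rewrite !mxE.
have dc : derivable c 0 1.
  apply/derivable_mxP => i j; rewrite cE (ord1 i).
  by have [] := is_derive_addM (p 0 j) _ _ (gw j).
have Dc : 'D_1 c 0 = w.
  rewrite derive_mx//; apply/matrixP => i j; rewrite mxE cE (ord1 i).
  by have [] := is_derive_addM (p 0 j) _ _ (gw j).
have dc' : differentiable c 0 by apply/derivable1_diffP.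
have df' : differentiable f (c 0) by rewrite c0.
rewrite -[fun t => _]/(f \o c) deriveE; last exact: differentiable_comp.
by rewrite diff_comp//= c0 -[X in 'd f p X]deriveE// Dc.
Qed.

End DeriveAlongCurve.

(** * Invariance of the differential at a fixed point *)

Section FixedPoint.
Context {R : realType}.
Local Notation C := R[i].
Implicit Types (T : 'M[int]_(2 + 2)) (B : 'M[C]_2) (F : 'M[C]_2 -> R).

(** [sp_den] is affine in the matrix, hence affine in t along a line. *)
Lemma cvg_sp_den T (p v : 'rV[R]_6) i j :
  (sp_den T (coords (p + t *: v)) i j : (C : numFieldType)) @[t --> (0 : R)] -->
  (sp_den T (coords p) i j : (C : numFieldType)).
Proof.
have E (t : R) : sp_den T (coords (p + t *: v)) i j =
    sp_den T (coords p) i j + t%:C%C * (intmx R (dlsubmx T) *m coords v) i j.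
  by rewrite /sp_den coords_line mulmxDr -scalemxAr addrAC mxE [X in _ + X]mxE.
under eq_cvg do rewrite E.
set N := (_ *m coords v) i j.
have tN : ((t%:C%C * N : (C : numFieldType)) @[t --> (0 : R)] -->
    ((0 : R)%:C%C * N : (C : numFieldType))).
  by apply: cvgMr_tmp; apply: cvg_real_complex; exact: cvg_id.
have : (sp_den T (coords p) i j + t%:C%C * N : (C : numFieldType)) @[t --> (0 : R)]
    --> (sp_den T (coords p) i j + (0 : R)%:C%C * N : (C : numFieldType)).
  by apply: cvgD tN; exact: cvg_cst.
by rewrite mul0r addr0.
Qed.

Lemma cvg_real_coords (Y : R -> 'M[C]_2) (Z : 'M[C]_2) :
  (forall i j, (Y t i j : (C : numFieldType)) @[t --> (0 : R)] -->
    (Z i j : (C : numFieldType))) ->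
  forall k, real_coords (Y t) 0 k @[t --> (0 : R)] --> real_coords Z 0 k.
Proof.
move=> YZ k; under eq_cvg do rewrite mxE; rewrite mxE.
by case: k => -[|[|[|[|[|[|//]]]]]] k /=;
  (exact: cvg_Re (YZ _ _) || exact: cvg_Im (YZ _ _)).
Qed.

(** The action maps the line p + t v to a curve through p. By invariance [f] takes the same values
    on both for t near 0, and the two sides are the derivatives at t = 0. *)
Lemma diff_sp_invariant F T (p v : 'rV[R]_6) (f := F \o @coords R)
    (W := sp_den T (coords p)) :
  (forall Z, H2 Z -> F (sp_act T Z) = F Z) -> Sp4Z T ->
  sp_num T (coords p) = coords p *m W -> W \in unitmx ->
  (\forall q \near p, H2 (coords q)) -> differentiable f p ->
  'd f p (real_coords ((invmx W)^T *m coords v *m invmx W)) = 'd f p v.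
Proof.
move=> Finv spT fixp uW nearH2 df.
pose Z (t : R) := coords (p + t *: v).
(* Chosen so that T.Z(t) = B + t Y(t) exactly, by [sp_act_sub_fixed]. *)
pose Y t := (invmx W)^T *m coords v *m invmx (sp_den T (Z t)).
have cvgY i j : (Y t i j : (C : numFieldType)) @[t --> (0 : R)] -->
    (((invmx W)^T *m coords v *m invmx W) i j : (C : numFieldType)).
  apply: (@cvg_mulmx (C : numFieldType)) => k l; first exact: cvg_cst.
  apply: (@cvg_invmx (C : numFieldType)) => // i' j'; exact: cvg_sp_den.
rewrite -(derive_along_curve f p _ (fun t => real_coords (Y t)) df); last first.
  exact: cvg_real_coords.
rewrite -(derive_along_curve f p v (fun=> v) df); last by move=> k; exact: cvg_cst.
apply: near_eq_derive.
have nearZ : \forall t \near (0 : R), H2 (Z t).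
  have : (p + t *: v) @[t --> (0 : R)] --> p + (0 : R) *: v.
    apply: (@cvgD R 'rV[R]_6 R (nbhs (0 : R)) _ (fun=> p) (fun t => t *: v)).
      exact: cvg_cst.
    exact: (@cvgZr_tmp R 'rV[R]_6 R (nbhs (0 : R)) _ id 0 v).
  by rewrite scale0r addr0 => /(_ _ nearH2).
have nearU : \forall t \near (0 : R), sp_den T (Z t) \in unitmx.
  exact: (@near_unitmx (C : numFieldType) R (nbhs (0 : R)) _ 2 _ W uW
    (cvg_sp_den T p v)).
near=> t.
have HZ : H2 (Z t) by near: t.
have uZ : sp_den T (Z t) \in unitmx by near: t.
have YE : sp_act T (Z t) = coords p + t%:C%C *: Y t.
  rewrite (sp_act_sub_fixed T (Z t) _ spT (coords_sym p) fixp uW uZ).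
  have -> : Z t - coords p = t%:C%C *: coords v.
    by rewrite /Z coords_line addrAC subrr add0r.
  by rewrite -scalemxAr -scalemxAl.
rewrite /f /= -(Finv _ HZ) -[p in LHS]coordsK -real_coords_line -YE.
by rewrite real_coordsK// sp_act_sym// coords_sym.
Unshelve. all: by end_near. Qed.

(** If W has eigenvalues l and m, the last two conditions on W say that l m, l^2 and m^2 differ from
    1, because (1 + l m)^2 - (l + m)^2 = (1 - l^2) (1 - m^2). *)
Lemma grad_vanishes_sp_fixed F T B (W := sp_den T B) :
  (forall Z, H2 Z -> F (sp_act T Z) = F Z) -> Sp4Z T ->
  sp_num T B = B *m W -> \det W != 0 ->
  \det W != 1 -> (1 + \det W) ^+ 2 != \tr W ^+ 2 ->
  C1_near F B -> grad_vanishes F B.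
Proof.
move=> Finv spT fixB W0 W1 W2 [U [oU UH [p Up pB] fd fc]].
have nearU : \forall q \near p, U q by exact: open_nbhs_nbhs.
have nearH2 : \forall q \near p, H2 (coords q).
  by apply: (filterS _ nearU) => q /UH.
have uW : W \in unitmx by rewrite unitmxE unitfE.
have df : differentiable (F \o @coords R) p.
  apply: C1_differentiable => k.
    by apply: (filterS _ nearU) => q Uq; exact: fd.
  exact: fc.
pose D k := 'd (F \o @coords R) p (evec R k).
have dE v : 'd (F \o @coords R) p v = v 0 0 * D 0 + v 0 1 * D 1 + v 0 2 * D 2 +
    v 0 3 * D 3 + v 0 4 * D 4 + v 0 5 * D 5.
  rewrite [v in LHS]row_sum_delta linear_sum /=.
  rewrite (eq_bigr (fun k => v 0 k * D k)); last by move=> k _; rewrite linearZ.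
  rewrite !big_ord_recl big_ord0 addr0 !addrA.
  by do !congr (_ + _); congr (v 0 _ * D _); exact: val_inj.
(* Conjugate coefficients, since Re ((a - i b) (x + i y)) = a x + b y: the differential becomes the
   real part of a complex linear form. *)
have [] := @sym_form_eq0 R W (D 0 -i* D 1)%C (D 2 -i* D 3)%C (D 4 -i* D 5)%C W1 W2.
  move=> x y z.
  have formE (K : 'M[C]_2) : complex.Re (sym_form (D 0 -i* D 1)%C
      (D 2 -i* D 3)%C (D 4 -i* D 5)%C K) = 'd (F \o @coords R) p (real_coords K).
    rewrite dE /sym_form !mxE /=.
    by case: (K 0 0) (K 0 1) (K 1 1) => a b [c d] [e g] /=; ring.
  have sK : (mx2 x y y z)^T = mx2 x y y z.
    apply/matrixP => i j; rewrite !mxE.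
    by have [->|->] := ord2P i; have [->|->] := ord2P j.
  (* Invariance is used in the direction W^T K W, which the differential of the action sends to
     K. *)
  rewrite !formE -(@diff_sp_invariant F T p) ?pB//.
  rewrite real_coordsK; last by rewrite !trmx_mul trmxK sK mulmxA.
  by rewrite -/W trmx_inv !mulmxA mulVmx ?unitmx_tr// mul1mx mulmxK.
have conj_eq0 (a b : R) : (a -i* b)%C = 0 -> a = 0 /\ b = 0.
  by case=> -> /eqP; rewrite oppr_eq0 => /eqP ->.
move=> /conj_eq0[D0 D1] /conj_eq0[D2 D3] /conj_eq0[D4 D5] q qB k.
have -> : q = p by rewrite -(coordsK q) qB -pB coordsK.
by rewrite deriveE// dE D0 D1 D2 D3 D4 D5 !mulr0 !addr0.
Qed.

End FixedPoint.

(** * Explicit stabilizers of the three points *)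

Section Stabilizers.
Context {R : realType}.
Local Notation C := R[i].

(* Stabilizers of [B1], [B2], [B3], of orders 8, 6 and 5, corresponding to the
   automorphisms of the three curves that multiply x by a root of unity of order
   4, 6 and 5. At the fixed point the eigenvalues of C B + D are
   {z^-1, z^-3} for z = e^(i pi / 4), {z^-1, z^-2} for z = e^(i pi / 3)
   and {eps5, eps5^3}. *)
Definition T1 : 'M[int]_(2 + 2) :=
  block_mx (mx2 0 (-1) (-1) 1) (mx2 1 0 (-1) 1) (mx2 (-1) 0 0 (-1))
    (mx2 (-1) 0 0 0).
Definition T2 : 'M[int]_(2 + 2) :=
  block_mx (mx2 0 0 0 0) (mx2 1 0 1 1) (mx2 (-1) 1 0 (-1)) (mx2 0 0 0 0).
Definition T3 : 'M[int]_(2 + 2) :=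
  block_mx (mx2 0 0 1 0) (mx2 0 (-1) 0 (-1)) (mx2 0 1 0 0)
    (mx2 (-1) (-1) 1 0).

Ltac solve_Sp4Z := rewrite /Sp4Z /= /Jmx tr_block_mx !mulmx_block
  !(mulmx0, mul0mx, mulmx1, mulmxN, mulNmx, add0r, addr0); congr block_mx;
  apply: mx2P; rewrite !mxE !sum2 !mxE.

Lemma T1_Sp4Z : Sp4Z T1. Proof. by solve_Sp4Z. Qed.
Lemma T2_Sp4Z : Sp4Z T2. Proof. by solve_Sp4Z. Qed.
Lemma T3_Sp4Z : Sp4Z T3. Proof. by solve_Sp4Z. Qed.

Lemma sqr_i_div_sqrt (n : nat) : ('i%C / sqrtR n%:R) ^+ 2 = - n%:R^-1 :> C.
Proof.
rewrite exprMn sqr_i mulN1r exprVn /sqrtR -rmorphXn /= sqr_sqrtr ?ler0n//.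
by rewrite rmorph_nat.
Qed.

Lemma deMoivre (x : R) n :
  ((cos x +i* sin x) ^+ n)%C = (cos (x *+ n) +i* sin (x *+ n))%C.
Proof.
elim: n => [|n IH]; first by rewrite expr0 mulr0n cos0 sin0.
by rewrite exprS IH mulrS cosD sinD /=; congr (_ +i* _)%C; rewrite addrC.
Qed.

Lemma eps5_neq1 : eps5 R != 1.
Proof.
rewrite /eps5 eq_complex /= negb_and; apply/orP; right.
rewrite gt_eqF// sin_gt0_pi//.
by have := pi_gt0 R; move: (pi : R) => x x0; apply/andP; split; lra.
Qed.

Lemma eps5_sum : 1 + eps5 R + eps5 R ^+ 2 + eps5 R ^+ 3 + eps5 R ^+ 4 = 0.
Proof.
have e5 : eps5 R ^+ 5 = 1.
  rewrite /eps5 deMoivre; have -> : 2 * pi / 5 *+ 5 = pi *+ 2 :> R by field.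
  by rewrite cos2pi sin2pi.
have : (eps5 R - 1) * (1 + eps5 R + eps5 R ^+ 2 + eps5 R ^+ 3 + eps5 R ^+ 4) = 0.
  by rewrite -[RHS](subrr 1) -[in X in _ = X - _]e5; ring.
by move=> /eqP; rewrite mulf_eq0 subr_eq0 (negbTE eps5_neq1) => /eqP.
Qed.

(** Proves identities modulo one polynomial relation r = 0. In each use below, q is the cofactor of
    r in x - y, and [ring] checks the resulting identity. *)
Lemma eq_of_vanishing (r q x y : C) : r = 0 -> x - y = q * r -> x = y.
Proof. by move=> -> /eqP; rewrite mulr0 subr_eq0 => /eqP. Qed.

Lemma B1_mx2 (s := 'i%C / sqrtR 2 : C) :
  B1 R = mx2 (s - 2^-1) 2^-1 2^-1 (s - 2^-1).
Proof. by apply: mx2P; rewrite !mxE. Qed.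

Lemma B2_mx2 (k := 'i%C / sqrtR 3 : C) : B2 R = mx2 (k * 2) k k (k * 2).
Proof. by apply: mx2P; rewrite !mxE /= ?mulr1. Qed.

Lemma B3_mx2 (e := eps5 R) :
  B3 R = mx2 e (e / (1 + e)) (e / (1 + e)) (1 - e ^+ 4).
Proof. by apply: mx2P; rewrite !mxE. Qed.

Lemma sp_num_block (a b c d : 'M[int]_2) (Z : 'M[C]_2) :
  sp_num (block_mx a b c d) Z = intmx R a *m Z + intmx R b.
Proof. by rewrite /sp_num block_mxKul block_mxKur. Qed.

Lemma sp_den_block (a b c d : 'M[int]_2) (Z : 'M[C]_2) :
  sp_den (block_mx a b c d) Z = intmx R c *m Z + intmx R d.
Proof. by rewrite /sp_den block_mxKdl block_mxKdr. Qed.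

Lemma B1_stabilizer (W := sp_den T1 (B1 R)) :
  [/\ sp_num T1 (B1 R) = B1 R *m W, \det W = -1 & \tr W ^+ 2 = - 2].
Proof.
rewrite /W /T1 sp_num_block sp_den_block B1_mx2 /intmx !map_mx2 !mx2M !mx2D mx2M.
rewrite det_mx22 tr_mx22 !mxE /= !(mulr0z, mulr1z, mulrNz).
have := sqr_i_div_sqrt 2; set s := _ / _ => ss.
(* Removing the constant 1/2 makes every entry a polynomial in s with integer coefficients, subject
   to 1 + 2 s^2 = 0. *)
have -> : 2^-1 = - s ^+ 2 by rewrite ss opprK.
have r0 : 1 + 2 * s ^+ 2 = 0 by rewrite ss mulrN mulfV ?subrr// pnatr_eq0.
split; [apply: mx2P; rewrite !mxE /=| |].
- by apply: (eq_of_vanishing _ (1 + s + s ^+ 2) _ _ r0); ring.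
- by apply: (eq_of_vanishing _ (- (s + s ^+ 2)) _ _ r0); ring.
- by apply: (eq_of_vanishing _ (- (1 + s + s ^+ 2)) _ _ r0); ring.
- by apply: (eq_of_vanishing _ (1 + s + s ^+ 2) _ _ r0); ring.
- by apply: (eq_of_vanishing _ (1 + s) _ _ r0); ring.
- by apply: (eq_of_vanishing _ (3 + 4 * s + 2 * s ^+ 2) _ _ r0); ring.
Qed.

Lemma B2_stabilizer (W := sp_den T2 (B2 R)) :
  [/\ sp_num T2 (B2 R) = B2 R *m W, \det W = -1 & \tr W ^+ 2 = - 3].
Proof.
rewrite /W /T2 sp_num_block sp_den_block B2_mx2 /intmx !map_mx2 !mx2M !mx2D mx2M.
rewrite det_mx22 tr_mx22 !mxE /= !(mulr0z, mulr1z, mulrNz).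
have := sqr_i_div_sqrt 3; set k := _ / _ => kk.
have r0 : 1 + 3 * k ^+ 2 = 0 by rewrite kk mulrN mulfV ?subrr// pnatr_eq0.
split; [apply: mx2P; rewrite !mxE /=| |].
- by apply: (eq_of_vanishing _ 1 _ _ r0); ring.
- by ring.
- by apply: (eq_of_vanishing _ 1 _ _ r0); ring.
- by apply: (eq_of_vanishing _ 1 _ _ r0); ring.
- by apply: (eq_of_vanishing _ 1 _ _ r0); ring.
- by apply: (eq_of_vanishing _ 3 _ _ r0); ring.
Qed.

Lemma B3_stabilizer (W := sp_den T3 (B3 R)) (e := eps5 R) :
  [/\ sp_num T3 (B3 R) = B3 R *m W, \det W = e ^+ 4 & \tr W = e + e ^+ 3].
Proof.
rewrite /W /T3 sp_num_block sp_den_block B3_mx2 /intmx !map_mx2 !mx2M !mx2D mx2M.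
rewrite det_mx22 tr_mx22 !mxE /= !(mulr0z, mulr1z, mulrNz) -/e.
have r0 := eps5_sum; rewrite -/e in r0.
(* The sum of the powers of e is 1 + (1 + e) (e + e^3), so 1 + e = 0 would force 1 = 0. *)
have e1 : 1 + e != 0.
  apply: contra_neq (oner_neq0 C) => e1.
  by rewrite -r0; apply/esym; apply: (eq_of_vanishing _ (e + e ^+ 3) _ _ e1); ring.
(* Clears the denominator: (1 + e) (e^2 + e^4) = e^2 + e^3 + e^4 + e^5, which is -e by the
   cyclotomic relation. *)
have -> : e / (1 + e) = - (e ^+ 2 + e ^+ 4).
  apply: (canLR (mulfK e1)).
  by apply: (eq_of_vanishing _ e _ _ r0); ring.
split; [apply: mx2P; rewrite !mxE /=| |].
- by apply: (eq_of_vanishing _ e _ _ r0); ring.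
- by apply: (eq_of_vanishing _ (e - 1) _ _ r0); ring.
- apply: (eq_of_vanishing _ (- 1 + 2 * e - 2 * e ^+ 2 + e ^+ 3 - e ^+ 4) _ _ r0).
  by ring.
- by apply: (eq_of_vanishing _ (- 1 + e - e ^+ 2 + e ^+ 3 - e ^+ 4) _ _ r0); ring.
- by ring.
- by apply: (eq_of_vanishing _ (- 1) _ _ r0); ring.
Qed.

End Stabilizers.

(** * Vanishing of the gradient at the three points *)

Theorem theorem5 (R : realType) (F : 'M[R[i]]_2 -> R) :
  (forall T, Sp4Z T -> forall Z, H2 Z -> F (sp_act T Z) = F Z) ->
  C1_near F (B1 R) -> C1_near F (B2 R) -> C1_near F (B3 R) ->
  [/\ grad_vanishes F (B1 R), grad_vanishes F (B2 R) & grad_vanishes F (B3 R)].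
Proof.
move=> Finv c1 c2 c3.
have N1_neq1 : -1 != 1 :> R[i].
  by rewrite eq_sym -subr_eq0 opprK -(natrD _ 1 1) pnatr_eq0.
(* For the first two points det W = -1, so the eigenvalue condition reduces to 0 being different
   from tr W squared, which is -2 or -3. *)
have sqr_neq (n : nat) : (1 + -1) ^+ 2 != - n.+1%:R :> R[i].
  by rewrite subrr expr0n /= eq_sym oppr_eq0 pnatr_eq0.
split.
- have [fixB detW trW] := @B1_stabilizer R.
  apply: (grad_vanishes_sp_fixed _ _ _ (Finv _ T1_Sp4Z) T1_Sp4Z fixB) => //.
  + by rewrite detW oppr_eq0 oner_eq0.
  + by rewrite detW.
  + by rewrite detW trW.
- have [fixB detW trW] := @B2_stabilizer R.
  apply: (grad_vanishes_sp_fixed _ _ _ (Finv _ T2_Sp4Z) T2_Sp4Z fixB) => //.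
  + by rewrite detW oppr_eq0 oner_eq0.
  + by rewrite detW.
  + by rewrite detW trW.
- have [fixB detW trW] := @B3_stabilizer R.
  have r0 := @eps5_sum R; have e1 := @eps5_neq1 R.
  set e := eps5 R in r0 e1 detW trW.
  have e5 : e ^+ 5 = 1 by apply: (eq_of_vanishing _ (e - 1) _ _ r0); ring.
  have e0 : e != 0.
    by apply: contra_eq_neq e5 => ->; rewrite expr0n eq_sym oner_eq0.
  have e1' : 1 + e != 0.
    apply: contra_neq (oner_neq0 R[i]) => h.
    by rewrite -r0; apply/esym; apply: (eq_of_vanishing _ (e + e ^+ 3) _ _ h); ring.
  apply: (grad_vanishes_sp_fixed _ _ _ (Finv _ T3_Sp4Z) T3_Sp4Z fixB) => //.
  + by rewrite detW expf_neq0.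
  + rewrite detW; apply: contra_neq e1 => e4.
    by rewrite -e5 exprS e4 mulr1.
  + rewrite detW trW -subr_eq0.
    (* The eigenvalues are e and e^3, and (1 - e^2) (1 - e^6) = (1 - e^2) (1 - e) because e^5 =
       1. *)
    have -> : (1 + e ^+ 4) ^+ 2 - (e + e ^+ 3) ^+ 2 = (1 - e) ^+ 2 * (1 + e).
      by apply: (eq_of_vanishing _ (e - e ^+ 2 - e ^+ 3 + e ^+ 4) _ _ r0); ring.
    by rewrite mulf_neq0// expf_neq0// subr_eq0 eq_sym.
Qed.
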